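(* Let $\omega_X,\omega_C,\gamma,g,\omega$ be real with $\gamma\neq0$, $g\ne0$, and write $\varpi_X=\omega-\omega_X$, $\varpi_C=\omega-\omega_C$. Let $(\psi_X(x,t),\psi_C(x,t))=(\phi_X(x),\phi_C(x))e^{-i\omega t}$, with nonconstant real envelopes, be a (stationary soliton) solution of the nonlinear polariton system $$i\partial_t\psi_X=(\omega_X+g|\psi_X|^2)\psi_X+\gamma\psi_C,\qquad i\partial_t\psi_C=(\omega_C-\tfrac12\partial_{xx})\psi_C+\gamma\psi_X \quad(\mathrm P)$$ such that $(\phi_X(x),\phi_C(x))$ has limits as $x\to\pm\infty$, i.e. one of the dark, bright or discontinuous solitons listed in the context, for which one has $$(\phi_X(x),\phi_C(x))\to\pm(\phi_X^*,\phi_C^* )\quad\text{as}\quad x\to\pm\infty .$$ Then the function pair $(\phi_X^*,\phi_C^* )e^{-i\omega t}$ is a homogeneous ($x$-independent) solution of (P) that is linearly stable if $\omega$ is in band 1.1, 2.1, 2.2, or 3.2, and linearly unstable if $\omega$ is in band 1.2 or 3.1. In bands 2.1 and 2.2, $(\phi_X^*,\phi_C^* )=(0,0)$, and in the other bands, $(\phi_X^*,\phi_C^* )=\pm(\phi_X^\infty,\phi_C^\infty)$, where $$\phi_X^\infty=\sqrt{\frac1g\left(\varpi_X-\frac{\gamma^2}{\varpi_C}\right)},\qquad \phi_C^\infty=\frac{\gamma}{\varpi_C}\phi_X^\infty .$$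
   Context: Solitons and bands. With real envelopes, (P) becomes $(g\phi_X^2-\varpi_X)\phi_X+\gamma\phi_C=0$, $-\frac12\phi_C''-\varpi_C\phi_C+\gamma\phi_X=0$. The stationary solitons are, up to translation in $x$: - Dark solitons ($g>0$): $\phi_X,\phi_C$ antisymmetric, monotonic, bounded. Band 1.1: $0<\varpi_X\varpi_C<\gamma^2$ and $\omega<\min\{\omega_C,\omega_X\}$. Band 1.2: $\gamma^2<\varpi_X\varpi_C<\frac32\gamma^2$ and $\omega>\max\{\omega_C,\omega_X\}$. - Bright solitons ($g<0$): $\phi_X,\phi_C$ symmetric, bounded, with a unique local maximum or minimum, vanishing as $|x|\to\infty$. Band 2.1: $\gamma^2<\varpi_X\varpi_C<\frac98\gamma^2$ and $\omega<\min\{\omega_C,\omega_X\}$. Band 2.2: $0<\varpi_X\varpi_C<\gamma^2$ and $\omega>\max\{\omega_C,\omega_X\}$. - Discontinuous solitons: $\phi_X,\phi_C$ antisymmetric and bounded, $\phi_C$ continuous, $\phi_X$ discontinuous at $x=0$, satisfying the envelope equations classically for $x\neq0$ and in the distributional sense on $\mathbb R$. Band 3.1 ($g<0$): $\omega<\min\{\omega_C,\omega_X\}$ and $\varpi_X\varpi_C>\frac32\gamma^2$; here $|\phi_X|$ decreases monotonically from $|\varpi_X/g|^{1/2}$ to $|g|^{-1/2}|\varpi_X-\gamma^2/\varpi_C|^{1/2}$ as $x$ runs from $0$ to $\infty$. Band 3.2 ($g>0$): $\omega_X<\omega<\omega_C$; here $|\phi_X|$ increases monotonically from $|\varpi_X/g|^{1/2}$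 to $|g|^{-1/2}|\varpi_X-\gamma^2/\varpi_C|^{1/2}$ as $x$ runs from $0$ to $\infty$. Linear stability. Let $(\phi_X^*,\phi_C^* )e^{-i\omega t}$ be a homogeneous solution of (P), and put $\zeta_*=g(\phi_X^* )^2$ and $\alpha_*=2\zeta_*-\varpi_X$. Linearizing (P) about it (perturbations and their complex conjugates, Laplace transform in time with variable $s$, $\tau=is$, spatial mode $k$) gives the dispersion relation $D(k,\tau)=0$, where, with $\beta=k^2-\varpi_C$, $$D(k,\tau)=\tau^4-\left(\alpha_*^2+\beta^2+2\gamma^2-\zeta_*^2\right)\tau^2+\left(\gamma^4-2\alpha_*\beta\gamma^2+\beta^2(\alpha_*^2-\zeta_*^2)\right),$$ which is the determinant of $$\begin{bmatrix}\alpha_*-\tau&\zeta_*&\gamma&0\\ \zeta_*&\alpha_*+\tau&0&\gamma\\ \gamma&0&\beta-\tau&0\\ 0&\gamma&0&\beta+\tau\end{bmatrix}.$$ (The spatial variable in the linearization is scaled so that $\frac12\partial_{xx}$ is replaced by $\partial_{xx}$; this does not affect the range $[-\varpi_C,\infty)$ of $\beta$.) The homogeneous solution is called linearly stable if $D(k,\tau)\ne0$ for all $k\in\mathbb R$ and all $\tau\in\mathbb C\setminus\mathbb R$; equivalently, for every real $k$ the two roots of $D$, viewed as a quadratic in $s^2=-\tau^2$, are real and negative or zero. Otherwise it is called linearly unstable. *)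

(* Defs.v *)
From Stdlib Require Export Reals.
From Coquelicot Require Export Coquelicot.
Open Scope R_scope.

(* Derivative of a complex-valued function of a real variable: C is taken as a
   normed module over R, not over itself. *)
Definition is_derive_C (f : R -> C) (x : R) (l : C) : Prop :=
  is_derive (f : R -> C_R_NormedModule) x l.

Definition is_derive2_C (f : R -> C) (x : R) (l : C) : Prop :=
  exists f' : R -> C,
    locally x (fun y => is_derive_C f y (f' y)) /\ is_derive_C f' x l.

Definition solves_P_at (omegaX omegaC gamma g : R) (psiX psiC : R -> R -> C)
    (x t : R) : Prop :=
  exists dt_psiX dt_psiC dxx_psiC : C,
    is_derive_C (fun t' => psiX x t') t dt_psiX /\
    is_derive_C (fun t' => psiC x t') t dt_psiC /\
    is_derive2_C (fun x' => psiC x' t) x dxx_psiC /\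
    (Ci * dt_psiX =
       RtoC (omegaX + g * Cmod (psiX x t) ^ 2) * psiX x t
         + RtoC gamma * psiC x t)%C /\
    (Ci * dt_psiC =
       RtoC omegaC * psiC x t - RtoC (1 / 2) * dxx_psiC
         + RtoC gamma * psiX x t)%C.

(* phi(x) e^{-i omega t}. *)
Definition stationary (omega : R) (phi : R -> R) (x t : R) : C :=
  Cmult (RtoC (phi x)) (cos (omega * t), - sin (omega * t)).

Definition classical_on (domain : R -> Prop) (omegaX omegaC gamma g omega : R)
    (phiX phiC : R -> R) : Prop :=
  forall x t : R, domain x ->
    solves_P_at omegaX omegaC gamma g
      (stationary omega phiX) (stationary omega phiC) x t.

Definition homogeneous_solution (omegaX omegaC gamma g omega aX aC : R) : Prop :=
  classical_on (fun _ => True) omegaX omegaC gamma g omega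
    (fun _ => aX) (fun _ => aC).

Definition test_function (a b : R) (chi : R -> R) : Prop :=
  a < b /\
  (forall (n : nat) (x : R), ex_derive_n chi n x) /\
  (forall x : R, ~ (a < x < b) -> chi x = 0).

(* The equations for the real envelopes of a stationary solution,
     (g phiX^2 - (omega - omegaX)) phiX + gamma phiC = 0,
     - phiC''/2 - (omega - omegaC) phiC + gamma phiX = 0,
   in the sense of distributions on R.  [is_RInt] includes integrability. *)
Definition distributional_envelopes (omegaX omegaC gamma g omega : R)
    (phiX phiC : R -> R) : Prop :=
  forall (a b : R) (chi : R -> R), test_function a b chi ->
    is_RInt (fun x =>
        ((g * phiX x ^ 2 - (omega - omegaX)) * phiX x + gamma * phiC x) * chi x)
      a b 0 /\
    is_RInt (fun x =>
        - (1 / 2) * phiC x * Derive_n chi 2 x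
        + (- (omega - omegaC) * phiC x + gamma * phiX x) * chi x)
      a b 0.

Definition band_1_1 (omegaX omegaC gamma g omega : R) : Prop :=
  0 < g /\
  0 < (omega - omegaX) * (omega - omegaC) < gamma ^ 2 /\
  omega < Rmin omegaC omegaX.

Definition band_1_2 (omegaX omegaC gamma g omega : R) : Prop :=
  0 < g /\
  gamma ^ 2 < (omega - omegaX) * (omega - omegaC) < 3 / 2 * gamma ^ 2 /\
  omega > Rmax omegaC omegaX.

Definition band_2_1 (omegaX omegaC gamma g omega : R) : Prop :=
  g < 0 /\
  gamma ^ 2 < (omega - omegaX) * (omega - omegaC) < 9 / 8 * gamma ^ 2 /\
  omega < Rmin omegaC omegaX.

Definition band_2_2 (omegaX omegaC gamma g omega : R) : Prop :=
  g < 0 /\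
  0 < (omega - omegaX) * (omega - omegaC) < gamma ^ 2 /\
  omega > Rmax omegaC omegaX.

Definition band_3_1 (omegaX omegaC gamma g omega : R) : Prop :=
  g < 0 /\
  (omega - omegaX) * (omega - omegaC) > 3 / 2 * gamma ^ 2 /\
  omega < Rmin omegaC omegaX.

Definition band_3_2 (omegaX omegaC gamma g omega : R) : Prop :=
  0 < g /\ omegaX < omega < omegaC.

Definition antisymmetric (f : R -> R) : Prop := forall x, f (- x) = - f x.

Definition symmetric (f : R -> R) : Prop := forall x, f (- x) = f x.

Definition bounded (f : R -> R) : Prop := exists M, forall x, Rabs (f x) <= M.

Definition nondecreasing_on (domain : R -> Prop) (f : R -> R) : Prop :=
  forall x y, domain x -> domain y -> x <= y -> f x <= f y.

Definition nonincreasing_on (domain : R -> Prop) (f : R -> R) : Prop :=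
  forall x y, domain x -> domain y -> x <= y -> f y <= f x.

Definition monotonic (f : R -> R) : Prop :=
  nondecreasing_on (fun _ => True) f \/ nonincreasing_on (fun _ => True) f.

Definition local_max (f : R -> R) (x : R) : Prop :=
  locally x (fun y => f y <= f x).

Definition local_min (f : R -> R) (x : R) : Prop :=
  locally x (fun y => f x <= f y).

Definition dark_profile (f : R -> R) : Prop :=
  antisymmetric f /\ monotonic f /\ bounded f.

Definition bright_profile (f : R -> R) : Prop :=
  symmetric f /\ bounded f /\
  ((exists! x, local_max f x) \/ (exists! x, local_min f x)) /\
  is_lim f p_infty 0 /\ is_lim f m_infty 0.

Definition discontinuous_profile (fX fC : R -> R) : Prop :=
  antisymmetric fX /\ antisymmetric fC /\ bounded fX /\ bounded fC /\
  (forall x, continuous fC x) /\ ~ continuous fX 0.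

Definition magnitude_range (omegaX omegaC gamma g omega : R) (fX : R -> R)
    : Prop :=
  let piX := omega - omegaX in
  let piC := omega - omegaC in
  filterlim (fun x => Rabs (fX x)) (at_right 0)
    (locally (sqrt (Rabs (piX / g)))) /\
  is_lim (fun x => Rabs (fX x)) p_infty
    (/ sqrt (Rabs g) * sqrt (Rabs (piX - gamma ^ 2 / piC))).

(* In each kind of soliton, x0 is the centre: the profiles are described up to
   translation. *)
Definition dark_soliton (omegaX omegaC gamma g omega : R) (phiX phiC : R -> R)
    : Prop :=
  (band_1_1 omegaX omegaC gamma g omega \/
   band_1_2 omegaX omegaC gamma g omega) /\
  classical_on (fun _ => True) omegaX omegaC gamma g omega phiX phiC /\
  exists x0 : R,
    dark_profile (fun x => phiX (x0 + x)) /\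
    dark_profile (fun x => phiC (x0 + x)).

Definition bright_soliton (omegaX omegaC gamma g omega : R) (phiX phiC : R -> R)
    : Prop :=
  (band_2_1 omegaX omegaC gamma g omega \/
   band_2_2 omegaX omegaC gamma g omega) /\
  classical_on (fun _ => True) omegaX omegaC gamma g omega phiX phiC /\
  exists x0 : R,
    bright_profile (fun x => phiX (x0 + x)) /\
    bright_profile (fun x => phiC (x0 + x)).

Definition discontinuous_soliton (omegaX omegaC gamma g omega : R)
    (phiX phiC : R -> R) : Prop :=
  distributional_envelopes omegaX omegaC gamma g omega phiX phiC /\
  exists x0 : R,
    classical_on (fun x => x <> x0) omegaX omegaC gamma g omega phiX phiC /\
    discontinuous_profile (fun x => phiX (x0 + x)) (fun x => phiC (x0 + x)) /\
    magnitude_range omegaX omegaC gamma g omega (fun x => phiX (x0 + x)) /\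
    ((band_3_1 omegaX omegaC gamma g omega /\
      nonincreasing_on (fun x => 0 < x) (fun x => Rabs (phiX (x0 + x)))) \/
     (band_3_2 omegaX omegaC gamma g omega /\
      nondecreasing_on (fun x => 0 < x) (fun x => Rabs (phiX (x0 + x))))).

Definition soliton (omegaX omegaC gamma g omega : R) (phiX phiC : R -> R)
    : Prop :=
  dark_soliton omegaX omegaC gamma g omega phiX phiC \/
  bright_soliton omegaX omegaC gamma g omega phiX phiC \/
  discontinuous_soliton omegaX omegaC gamma g omega phiX phiC.

Definition nonconstant (phiX phiC : R -> R) : Prop :=
  ~ exists cX cC : R, forall x, phiX x = cX /\ phiC x = cC.

(* The determinant of
     [ alpha - tau   zeta          gamma        0          ]
     [ zeta          alpha + tau   0            gamma      ]
     [ gamma         0             beta - tau   0          ]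
     [ 0             gamma         0            beta + tau ]
   obtained by linearizing the system about the homogeneous solution with
   X-component aX, for the spatial mode k. *)
Definition dispersion (omegaX omegaC gamma g omega aX k : R) (tau : C) : C :=
  let zeta := g * aX ^ 2 in
  let alpha := 2 * zeta - (omega - omegaX) in
  let beta := k ^ 2 - (omega - omegaC) in
  (tau ^ 4
   - RtoC (alpha ^ 2 + beta ^ 2 + 2 * gamma ^ 2 - zeta ^ 2) * tau ^ 2
   + RtoC (gamma ^ 4 - 2 * alpha * beta * gamma ^ 2
           + beta ^ 2 * (alpha ^ 2 - zeta ^ 2)))%C.

Definition linearly_stable (omegaX omegaC gamma g omega aX : R) : Prop :=
  forall (k : R) (tau : C), Im tau <> 0 ->
    dispersion omegaX omegaC gamma g omega aX k tau <> RtoC 0.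

Definition linearly_unstable (omegaX omegaC gamma g omega aX : R) : Prop :=
  ~ linearly_stable omegaX omegaC gamma g omega aX.

Definition phiX_inf (omegaX omegaC gamma g omega : R) : R :=
  sqrt (1 / g * ((omega - omegaX) - gamma ^ 2 / (omega - omegaC))).

Definition phiC_inf (omegaX omegaC gamma g omega : R) : R :=
  gamma / (omega - omegaC) * phiX_inf omegaX omegaC gamma g omega.

(* Main.v *)
Require Import Defs.
From Stdlib Require Import Reals Lra.
From Coquelicot Require Import Coquelicot.
Open Scope R_scope.

(** Both [phiC] and, by the second envelope equation, [phiC''] converge at
    infinity, which forces [phiC'' -> 0]; so the limits satisfy the algebraic
    equations of a homogeneous solution.  Bright profiles vanish at infinity, a
    monotone antisymmetric profile vanishing at infinity is zero, and the
    prescribed range of [|phiX|] excludes a zero limit of a discontinuous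
    soliton; this separates the zero and nonzero homogeneous states.
    The dispersion polynomial [tau^4 - b tau^2 + q] has only real roots iff
    [b >= 0], [q >= 0] and [b^2 >= 4 q].  At the zero state this always holds.
    At the nonzero state it holds when [varpi_C < 0 <= zeta]; in band 1.2 the
    discriminant is negative at a suitable [beta], and in band 3.1 one has
    [q < 0] for [beta > - varpi_C]. *)

(** * Real and nonreal roots of the dispersion quartic *)

(** For [tau = u + i v] the imaginary part forces [u = 0] or [b = 2 (u^2 - v^2)]. In the second case
    the real part gives [q = (u^2 + v^2)^2], hence [b^2 - 4 q = - 16 u^2 v^2 < 0]. *)
Lemma quartic_no_nonreal_root (b q : R) (tau : C) :
  0 <= b -> 0 <= q -> 4 * q <= b ^ 2 -> Im tau <> 0 ->
  (tau ^ 4 - RtoC b * tau ^ 2 + RtoC q)%C <> RtoC 0.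
Proof.
destruct tau as [u v]; unfold Im; simpl (snd _).
intros Hb Hq Hd Hv E.
injection E; intros EI ER; ring_simplify in EI; ring_simplify in ER.
assert (Hv2 : 0 < v ^ 2) by (apply pow2_gt_0; assumption).
destruct (Req_dec u 0) as [-> | Hu].
- nra.
- assert (Hu2 : 0 < u ^ 2) by (apply pow2_gt_0; assumption).
  assert (Eb : b = 2 * (u ^ 2 - v ^ 2)).
  { apply (Rmult_eq_reg_l (2 * (u * v))); [nra |].
    apply Rmult_integral_contrapositive; split; [lra |].
    now apply Rmult_integral_contrapositive. }
  assert (Eq : q = (u ^ 2 + v ^ 2) ^ 2) by (subst b; nra).
  assert (0 < u ^ 2 * v ^ 2) by now apply Rmult_lt_0_compat.
  subst b q; nra.
Qed.

Lemma quartic_nonreal_root (b q : R) :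
  q < 0 \/ b ^ 2 < 4 * q ->
  exists tau : C, Im tau <> 0 /\
    (tau ^ 4 - RtoC b * tau ^ 2 + RtoC q)%C = RtoC 0.
Proof.
intros [Hq | Hd].
- set (s := sqrt (b ^ 2 - 4 * q)).
  assert (Hs : s * s = b ^ 2 - 4 * q) by (apply sqrt_sqrt; nra).
  assert (Hs0 : 0 <= s) by apply sqrt_pos.
  assert (Hsb : b < s) by nra.
  (* [i v] squares to [(b - s) / 2], the negative root of the quadratic in [tau^2]. *)
  set (v := sqrt ((s - b) / 2)).
  assert (Hv : v * v = (s - b) / 2) by (apply sqrt_sqrt; lra).
  exists (0, v); split; [simpl; nra |].
  apply injective_projections; simpl; nra.
- assert (Hq : 0 < q) by nra.
  set (m := sqrt q).
  assert (Hm : m * m = q) by (apply sqrt_sqrt; lra).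
  assert (Hm0 : 0 < m) by now apply sqrt_lt_R0.
  assert (Hbm : - (2 * m) < b < 2 * m) by (split; nra).
  (* The quadratic in [tau^2] has conjugate roots of modulus [m] and real part [b / 2]; solving
     [u^2 + v^2 = m] and [u^2 - v^2 = b / 2] gives a square root of one of them. *)
  set (u := sqrt ((2 * m + b) / 4)).
  set (v := sqrt ((2 * m - b) / 4)).
  assert (Hu : u * u = (2 * m + b) / 4) by (apply sqrt_sqrt; lra).
  assert (Hv : v * v = (2 * m - b) / 4) by (apply sqrt_sqrt; lra).
  exists (u, v); split; [simpl; nra |].
  apply injective_projections; simpl; ring_simplify.
  + replace (u ^ 4) with ((u * u) ^ 2) by ring.
    replace (v ^ 4) with ((v * v) ^ 2) by ring.
    replace (u ^ 2) with (u * u) by ring.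
    replace (v ^ 2) with (v * v) by ring.
    rewrite Hu, Hv, <- Hm; field.
  + replace (4 * u ^ 3 * v - 4 * u * v ^ 3 - 2 * u * v * b)
      with (2 * u * v * (2 * (u * u) - 2 * (v * v) - b)) by ring.
    rewrite Hu, Hv; field.
Qed.

(** * Linear stability of the homogeneous states *)

(** With [zeta = 0] the linearization decouples into two real symmetric blocks. Accordingly the
    constant term is a square, and the discriminant is [(beta^2 - p^2)^2 + 4 gamma^2 (beta -
    p)^2]. *)
Lemma linearly_stable_zero (omegaX omegaC gamma g omega : R) :
  linearly_stable omegaX omegaC gamma g omega 0.
Proof.
intros k tau Htau; unfold dispersion.
set (p := omega - omegaX); set (beta := k ^ 2 - (omega - omegaC)).
assert (H := pow2_ge_0 (beta - p)); assert (H' := pow2_ge_0 (beta ^ 2 - p ^ 2)).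
assert (H'' := pow2_ge_0 (gamma * (beta - p))).
apply quartic_no_nonreal_root; [.. | assumption].
- assert (Hg := pow2_ge_0 gamma); nra.
- replace (_ + _) with ((gamma ^ 2 + p * beta) ^ 2) by ring.
  apply pow2_ge_0.
- nra.
Qed.

(* With [A = alpha^2 - zeta^2], the discriminant in [tau^2] is
   [(A - beta^2)^2 + 4 gamma^2 (alpha - zeta + beta) (alpha + zeta + beta)], and
   the constant term is
   [(gamma^2 - (alpha + zeta) beta) (gamma^2 - (alpha - zeta) beta)], where
   [alpha - zeta = - gamma^2 / varpi_C] at the nonzero homogeneous solution. *)
Lemma linearly_stable_nonzero (omegaX omegaC gamma g omega aX : R) :
  omega - omegaC < 0 -> 0 <= g * aX ^ 2 ->
  g * aX ^ 2 = (omega - omegaX) - gamma ^ 2 / (omega - omegaC) ->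
  linearly_stable omegaX omegaC gamma g omega aX.
Proof.
intros Hc Hz Ez k tau Htau; unfold dispersion.
set (zeta := g * aX ^ 2) in *; set (p := omega - omegaX) in *.
set (c := omega - omegaC) in *; set (beta := k ^ 2 - c).
(* Here [e = alpha - zeta], so that [alpha + zeta = e + 2 zeta]. *)
set (e := - gamma ^ 2 / c).
assert (Hce : - c * e = gamma ^ 2) by (unfold e; field; lra).
assert (Ep : p = zeta - e) by (unfold e; rewrite Ez; field; lra).
assert (Hg := pow2_ge_0 gamma).
assert (He : 0 <= e) by nra.
assert (Hbeta : - c <= beta) by (unfold beta; assert (H := pow2_ge_0 k); lra).
clearbody beta e p zeta; subst p.
assert (Hze : 0 <= zeta * e) by now apply Rmult_le_pos.
(* The range [beta >= - c] enters here, through [gamma ^ 2 = - c * e]; it gives both factors of the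
   constant term the same sign. *)
assert (Hbe : gamma ^ 2 <= e * beta) by nra.
assert (Hzb : 0 <= zeta * beta) by (apply Rmult_le_pos; lra).
apply quartic_no_nonreal_root; [.. | assumption].
- assert (H := pow2_ge_0 beta); nra.
- replace (_ + _)
    with ((e * beta + 2 * (zeta * beta) - gamma ^ 2) * (e * beta - gamma ^ 2))
    by ring.
  apply Rmult_le_pos; lra.
- apply Rminus_le_0.
  match goal with |- 0 <= ?E =>
    replace E with (((e ^ 2 + 2 * (zeta * e)) - beta ^ 2) ^ 2
      + 4 * gamma ^ 2 * ((e + beta) * (e + 2 * zeta + beta))) by ring end.
  apply Rplus_le_le_0_compat; [apply pow2_ge_0 |].
  apply Rmult_le_pos; [lra | apply Rmult_le_pos; lra].
Qed.

(** The mode [k] enters only through [beta], and every [beta >= - varpi_C] is attained at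
    [k = sqrt (beta + varpi_C)]. *)
Lemma linearly_unstable_of_coeffs (omegaX omegaC gamma g omega aX beta : R) :
  let zeta := g * aX ^ 2 in
  let alpha := 2 * zeta - (omega - omegaX) in
  let b := alpha ^ 2 + beta ^ 2 + 2 * gamma ^ 2 - zeta ^ 2 in
  let q := gamma ^ 4 - 2 * alpha * beta * gamma ^ 2
           + beta ^ 2 * (alpha ^ 2 - zeta ^ 2) in
  - (omega - omegaC) <= beta -> q < 0 \/ b ^ 2 < 4 * q ->
  linearly_unstable omegaX omegaC gamma g omega aX.
Proof.
intros zeta alpha b q Hbeta Hbq Hs.
destruct (quartic_nonreal_root b q Hbq) as (tau & Htau & E).
apply (Hs (sqrt (beta + (omega - omegaC))) tau Htau).
unfold dispersion; rewrite pow2_sqrt by lra.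
replace (beta + (omega - omegaC) - (omega - omegaC)) with beta by ring.
exact E.
Qed.

(* At [beta^2 = alpha^2 - zeta^2] the discriminant in [tau^2] reduces to
   [4 gamma^2 (alpha - zeta + beta) (alpha + zeta + beta)]; as [beta] is then the
   geometric mean of [- (alpha - zeta)] and [- (alpha + zeta)], this is negative. *)
Lemma linearly_unstable_pos (omegaX omegaC gamma g omega aX : R) :
  gamma <> 0 -> 0 < omega - omegaC ->
  gamma ^ 2 < (omega - omegaX) * (omega - omegaC) < 3 / 2 * gamma ^ 2 ->
  g * aX ^ 2 = (omega - omegaX) - gamma ^ 2 / (omega - omegaC) ->
  linearly_unstable omegaX omegaC gamma g omega aX.
Proof.
intros Hgamma Hc Hpc Ez.
set (f := gamma ^ 2 / (omega - omegaC)) in *.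
(* In the notation above, [f = - (alpha - zeta)] and [e = - (alpha + zeta)]. The bound [3 / 2] is
   exactly what makes [e] positive, since [varpi_C * e = 3 gamma^2 - 2 varpi_X varpi_C]. *)
set (e := f - 2 * (g * aX ^ 2)).
assert (Hcf : (omega - omegaC) * f = gamma ^ 2) by (unfold f; field; lra).
assert (Hg : 0 < gamma ^ 2) by now apply pow2_gt_0.
assert (He : 0 < e) by (unfold e; nra).
assert (Hef : e < f) by (unfold e; nra).
apply linearly_unstable_of_coeffs with (beta := sqrt (e * f)).
{ assert (H := sqrt_pos (e * f)); lra. }
right.
assert (Hs : sqrt (e * f) * sqrt (e * f) = e * f) by (apply sqrt_sqrt; nra).
assert (Hs0 := sqrt_pos (e * f)).
set (beta := sqrt (e * f)) in *.
assert (Hb : e < beta < f) by (split; nra).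
replace (omega - omegaX) with (g * aX ^ 2 + f) by lra.
replace (g * aX ^ 2) with ((f - e) / 2) by (unfold e; field).
apply Rminus_lt_0.
match goal with |- 0 < ?E =>
  replace E with (4 * gamma ^ 2 * ((beta - e) * (f - beta))
    - (e * f - beta * beta) ^ 2) by field end.
rewrite Hs.
assert (0 < (beta - e) * (f - beta)) by (apply Rmult_lt_0_compat; lra).
nra.
Qed.

(** Here [alpha - zeta = f > 0], and the bound [3 / 2] makes [alpha + zeta = - e] negative. The
    constant term [(gamma^2 + e beta) (gamma^2 - f beta)] is then negative as soon as
    [beta > - varpi_C], because [- varpi_C * f = gamma^2]. *)
Lemma linearly_unstable_neg (omegaX omegaC gamma g omega aX : R) :
  gamma <> 0 -> omega - omegaC < 0 ->
  (omega - omegaX) * (omega - omegaC) > 3 / 2 * gamma ^ 2 ->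
  g * aX ^ 2 = (omega - omegaX) - gamma ^ 2 / (omega - omegaC) ->
  linearly_unstable omegaX omegaC gamma g omega aX.
Proof.
intros Hgamma Hc Hpc Ez.
set (f := - gamma ^ 2 / (omega - omegaC)).
assert (Ef : gamma ^ 2 / (omega - omegaC) = - f) by (unfold f; field; lra).
assert (Hcf : - (omega - omegaC) * f = gamma ^ 2) by (unfold f; field; lra).
assert (Hg : 0 < gamma ^ 2) by now apply pow2_gt_0.
rewrite Ef in Ez; clearbody f.
assert (Hf : 0 < f) by nra.
apply linearly_unstable_of_coeffs with (beta := - (omega - omegaC) + 1); [lra |].
left.
set (e := - (f + 2 * (g * aX ^ 2))).
assert (He : 0 < e) by (unfold e; nra).
replace (omega - omegaX) with (g * aX ^ 2 - f) by lra.
replace (g * aX ^ 2) with (- (f + e) / 2) by (unfold e; field).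
set (beta := - (omega - omegaC) + 1).
match goal with |- ?E < 0 =>
  replace E with (- ((gamma ^ 2 + e * beta) * (f * beta - gamma ^ 2))) by field end.
apply Ropp_lt_gt_0_contravar, Rmult_lt_0_compat.
- assert (0 < e * beta) by (apply Rmult_lt_0_compat; unfold beta; lra); lra.
- unfold beta; nra.
Qed.

(** * Passage between the complex system and the real envelope equations *)

Lemma is_derive_C_pair (f g : R -> R) (x a b : R) :
  is_derive f x a -> is_derive g x b ->
  is_derive_C (fun y => (f y, g y)) x (a, b).
Proof.
intros Hf Hg.
refine (filterdiff_ext_lin (fun y => (f y, g y)) _ _ _ _).
- apply (filterdiff_comp_2 f g (fun u v => (u, v)) _ _ (fun u v => (u, v)) Hf Hg).
  apply filterdiff_linear.
  apply is_linear_prod; [apply is_linear_fst | apply is_linear_snd].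
- intros y; reflexivity.
Qed.

Lemma is_derive_C_fst (f : R -> C) (x : R) (l : C) :
  is_derive_C f x l -> is_derive (fun y => fst (f y)) x (fst l).
Proof.
intros H.
exact (filterdiff_comp f (fun u : C_R_NormedModule => fst u) _ (fun u => fst u) H
         (filterdiff_linear _ is_linear_fst)).
Qed.

Lemma is_derive_C_snd (f : R -> C) (x : R) (l : C) :
  is_derive_C f x l -> is_derive (fun y => snd (f y)) x (snd l).
Proof.
intros H.
exact (filterdiff_comp f (fun u : C_R_NormedModule => snd u) _ (fun u => snd u) H
         (filterdiff_linear _ is_linear_snd)).
Qed.

Lemma Cmod_stationary (omega : R) (phi : R -> R) (x t : R) :
  Cmod (stationary omega phi x t) ^ 2 = phi x ^ 2.
Proof.
assert (H := sin2_cos2 (omega * t)); unfold Rsqr in H.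
unfold Cmod; rewrite pow2_sqrt.
- simpl.
  replace (phi x * (phi x * 1))
    with (phi x * phi x * (sin (omega * t) * sin (omega * t)
            + cos (omega * t) * cos (omega * t))) by (rewrite H; ring).
  ring.
- apply Rplus_le_le_0_compat; apply pow2_ge_0.
Qed.

Lemma is_derive_stationary (omega : R) (phi : R -> R) (x t : R) :
  is_derive_C (fun t' => stationary omega phi x t') t
    (- omega * (phi x * sin (omega * t)), - omega * (phi x * cos (omega * t))).
Proof.
apply (is_derive_C_pair
  (fun t' => phi x * cos (omega * t') - 0 * - sin (omega * t'))
  (fun t' => phi x * - sin (omega * t') + 0 * cos (omega * t')));
  auto_derive; trivial; ring.
Qed.

Lemma homogeneous_solution_of_envelopes (omegaX omegaC gamma g omega aX aC : R) :
  (g * aX ^ 2 - (omega - omegaX)) * aX + gamma * aC = 0 ->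
  - (omega - omegaC) * aC + gamma * aX = 0 ->
  homogeneous_solution omegaX omegaC gamma g omega aX aC.
Proof.
intros EX EC x t _.
eexists; eexists; exists (RtoC 0).
split; [apply is_derive_stationary |].
split; [apply is_derive_stationary |].
split; [| split].
- exists (fun _ => RtoC 0).
  split; [apply filter_forall; intros y |];
    apply (is_derive_C_pair (fun _ => _) (fun _ => _)); apply @is_derive_const.
- rewrite Cmod_stationary.
  (* Real and imaginary parts are the envelope equation times [cos] and [- sin]. *)
  assert (Hc := f_equal (Rmult (cos (omega * t))) EX).
  assert (Hs := f_equal (Rmult (sin (omega * t))) EX).
  apply injective_projections; simpl in *; lra.
- assert (Hc := f_equal (Rmult (cos (omega * t))) EC).
  assert (Hs := f_equal (Rmult (sin (omega * t))) EC).
  apply injective_projections; simpl in *; lra.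
Qed.

(** At time [0] the phase is [1], and the real parts of the two equations are the envelope
    equations. *)
Lemma envelopes_of_solution (omegaX omegaC gamma g omega : R) (phiX phiC : R -> R)
    (x : R) :
  solves_P_at omegaX omegaC gamma g
    (stationary omega phiX) (stationary omega phiC) x 0 ->
  (g * phiX x ^ 2 - (omega - omegaX)) * phiX x + gamma * phiC x = 0 /\
  ex_derive phiC x /\
  is_derive (Derive phiC) x (2 * (gamma * phiX x - (omega - omegaC) * phiC x)).
Proof.
intros (dX & dC & dxxC & HX & HC & (f' & Hf' & Hf'') & EX & EC).
rewrite Cmod_stationary in EX.
(* The real part of [i d] is [- snd d], so only this component of the time derivative is needed. *)
assert (Ht : forall phi d,
  is_derive_C (fun t' => stationary omega phi x t') 0 d -> snd d = - omega * phi x).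
{ intros phi d Hd.
  rewrite <- (is_derive_unique _ _ _ (is_derive_C_snd _ _ _ Hd)).
  rewrite (is_derive_unique _ _ _
    (is_derive_C_snd _ _ _ (is_derive_stationary omega phi x 0))).
  simpl; rewrite Rmult_0_r, cos_0; ring. }
apply Ht in HX, HC.
assert (Hfst : forall y, fst (stationary omega phiC y 0) = phiC y).
{ intros y; simpl; rewrite Rmult_0_r, cos_0, sin_0; ring. }
assert (HD : locally x (fun y => is_derive phiC y (fst (f' y)))).
{ revert Hf'; apply filter_imp; intros y Hy.
  apply (is_derive_ext (fun z => fst (stationary omega phiC z 0))); [exact Hfst |].
  now apply is_derive_C_fst. }
assert (HD2 : is_derive (Derive phiC) x (fst dxxC)).
{ apply (is_derive_ext_loc (fun y => fst (f' y))).
  - revert HD; apply filter_imp; intros y Hy.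
    symmetry; now apply is_derive_unique.
  - now apply is_derive_C_fst. }
apply (f_equal fst) in EX, EC.
simpl in EX, EC; rewrite HX in EX; rewrite HC in EC.
rewrite Rmult_0_r, cos_0, sin_0 in EX, EC.
split; [| split].
- simpl; lra.
- eexists; exact (locally_singleton _ _ HD).
- replace (2 * _) with (fst dxxC) by lra; exact HD2.
Qed.

(** * Limits at infinity *)

(** Two mean value theorems write [f (x + 2) - 2 f (x + 1) + f x] as [f2 z]. With tolerance
    [|L| / 8] the left side is below [|L| / 2] in absolute value, the right side above
    [7 |L| / 8]. *)
Lemma is_lim_derive2_zero (f f1 f2 : R -> R) (a l L : R) :
  (forall x, a < x -> is_derive f x (f1 x)) ->
  (forall x, a < x -> is_derive f1 x (f2 x)) ->
  is_lim f p_infty l -> is_lim f2 p_infty L -> L = 0.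
Proof.
intros Hf1 Hf2 Hl HL.
destruct (Req_dec L 0) as [| HL0]; [assumption | exfalso].
apply is_lim_spec in Hl; apply is_lim_spec in HL.
assert (HLp : 0 < Rabs L) by now apply Rabs_pos_lt.
assert (He : 0 < Rabs L / 8) by lra.
destruct (Hl (mkposreal _ He)) as [M1 H1], (HL (mkposreal _ He)) as [M2 H2].
simpl in H1, H2.
set (x := Rmax a (Rmax M1 M2) + 1).
assert (Hx : a < x /\ M1 < x /\ M2 < x).
{ assert (Ha := Rmax_l a (Rmax M1 M2)); assert (Hb := Rmax_r a (Rmax M1 M2)).
  assert (Hc := Rmax_l M1 M2); assert (Hd := Rmax_r M1 M2).
  unfold x; lra. }
assert (Hh : forall y, x <= y ->
  is_derive (fun z => f (z + 1) - f z) y (f1 (y + 1) - f1 y)).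
{ intros y Hy; apply @is_derive_minus; [| apply Hf1; lra].
  rewrite <- (Rmult_1_l (f1 (y + 1))).
  apply (is_derive_comp f (fun z => z + 1)).
  - apply Hf1; lra.
  - auto_derive; trivial. }
destruct (MVT_gen (fun z => f (z + 1) - f z) x (x + 1)
            (fun y => f1 (y + 1) - f1 y)) as (y & Hy & Ey).
{ rewrite Rmin_left by lra; intros y Hy; apply Hh; lra. }
{ rewrite Rmin_left by lra; intros y Hy.
  apply continuity_pt_filterlim, (ex_derive_continuous (fun z => f (z + 1) - f z)).
  eexists; apply Hh; lra. }
rewrite Rmin_left, Rmax_right in Hy by lra.
destruct (MVT_gen f1 y (y + 1) f2) as (z & Hz & Ez).
{ rewrite Rmin_left by lra; intros z Hz; apply Hf2; lra. }
{ rewrite Rmin_left by lra; intros z Hz.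
  apply continuity_pt_filterlim, (ex_derive_continuous f1).
  eexists; apply Hf2; lra. }
rewrite Rmin_left, Rmax_right in Hz by lra.
assert (K0 := H1 x ltac:(lra)); assert (K1 := H1 (x + 1) ltac:(lra)).
assert (K2 := H1 (x + 1 + 1) ltac:(lra)); assert (K3 := H2 z ltac:(lra)).
apply Rabs_def2 in K0, K1, K2, K3.
revert HLp K0 K1 K2 K3; unfold Rabs; destruct (Rcase_abs L); lra.
Qed.

Lemma is_lim_finite_unique (f : R -> R) (x : Rbar) (l l' : R) :
  is_lim f x l -> is_lim f x l' -> l = l'.
Proof.
intros H H'; apply is_lim_unique in H, H'.
rewrite H in H'; now injection H'.
Qed.

Lemma is_lim_linear_combination (f1 f2 : R -> R) (x : Rbar) (a b l1 l2 : R) :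
  is_lim f1 x l1 -> is_lim f2 x l2 ->
  is_lim (fun y => a * f1 y + b * f2 y) x (a * l1 + b * l2).
Proof.
intros H1 H2; apply is_lim_plus'.
- exact (is_lim_scal_l f1 a x l1 H1).
- exact (is_lim_scal_l f2 b x l2 H2).
Qed.

(** Only the half-line to the right of [x0] is involved, so a jump at [x0] is harmless. *)
Lemma asymptotic_envelopes (omegaX omegaC gamma g omega : R) (phiX phiC : R -> R)
    (x0 aX aC : R) :
  classical_on (fun x => x <> x0) omegaX omegaC gamma g omega phiX phiC ->
  is_lim phiX p_infty aX -> is_lim phiC p_infty aC ->
  (g * aX ^ 2 - (omega - omegaX)) * aX + gamma * aC = 0 /\
  - (omega - omegaC) * aC + gamma * aX = 0.
Proof.
intros Hcl HX HC.
assert (Henv := fun x (Hx : x0 < x) =>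
  envelopes_of_solution _ _ _ _ _ _ _ _ (Hcl x 0 (Rgt_not_eq _ _ Hx))).
split.
- set (F := fun u => (g * u ^ 2 - (omega - omegaX)) * u).
  assert (HF : is_lim (fun x => F (phiX x)) p_infty (F aX)).
  { apply is_lim_comp_continuous; [exact HX |].
    apply @ex_derive_continuous; unfold F; auto_derive; trivial. }
  assert (H := is_lim_linear_combination _ _ _ 1 gamma _ _ HF HC).
  rewrite Rmult_1_l in H.
  refine (is_lim_finite_unique _ _ _ _ H _).
  apply (is_lim_ext_loc (fun _ => 0)); [| apply is_lim_const].
  exists x0; intros x Hx; unfold F; rewrite Rmult_1_l; symmetry; apply Henv, Hx.
- assert (H : 2 * gamma * aX + - 2 * (omega - omegaC) * aC = 0); [| lra].
  apply (is_lim_derive2_zero phiC (Derive phiC)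
    (fun x => 2 * gamma * phiX x + - 2 * (omega - omegaC) * phiC x) x0 aC).
  + intros x Hx; apply Derive_correct, Henv, Hx.
  + intros x Hx.
    replace (_ + _) with (2 * (gamma * phiX x - (omega - omegaC) * phiC x)) by ring.
    apply Henv, Hx.
  + exact HC.
  + now apply is_lim_linear_combination.
Qed.

Lemma is_lim_shift (f : R -> R) (a l : R) :
  is_lim f p_infty l -> is_lim (fun x => f (a + x)) p_infty l.
Proof.
intros H; apply is_lim_spec in H; apply is_lim_spec; intros eps.
destruct (H eps) as [M HM]; exists (M - a); intros x Hx; apply HM; lra.
Qed.

Lemma is_lim_reflect (f : R -> R) (a l : R) :
  is_lim f p_infty l -> is_lim (fun x => f (a - x)) m_infty l.
Proof.
intros H; apply is_lim_spec in H; apply is_lim_spec; intros eps.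
destruct (H eps) as [M HM]; exists (a - M); intros x Hx; apply HM; lra.
Qed.

Lemma is_lim_antisymmetric (f : R -> R) (x0 l : R) :
  antisymmetric (fun x => f (x0 + x)) -> is_lim f p_infty l ->
  is_lim f m_infty (- l).
Proof.
intros Ha Hl.
apply (is_lim_ext (fun x => - f (2 * x0 - x))).
- intros x; specialize (Ha (x0 - x)); simpl in Ha.
  replace (x0 + - (x0 - x)) with x in Ha by ring.
  replace (x0 + (x0 - x)) with (2 * x0 - x) in Ha by ring; lra.
- exact (is_lim_opp _ _ _ (is_lim_reflect f (2 * x0) l Hl)).
Qed.

Lemma is_lim_symmetric (f : R -> R) (x0 l : R) :
  symmetric (fun x => f (x0 + x)) -> is_lim f p_infty l ->
  is_lim f m_infty l.
Proof.
intros Hs Hl.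
apply (is_lim_ext (fun x => f (2 * x0 - x))).
- intros x; specialize (Hs (x0 - x)); simpl in Hs.
  replace (x0 + - (x0 - x)) with x in Hs by ring.
  replace (x0 + (x0 - x)) with (2 * x0 - x) in Hs by ring; now symmetry.
- exact (is_lim_reflect f (2 * x0) l Hl).
Qed.

Lemma nondecreasing_le_lim (f : R -> R) (l x : R) :
  nondecreasing_on (fun _ => True) f -> is_lim f p_infty l -> f x <= l.
Proof.
intros Hf Hl.
apply (is_lim_le_loc (fun _ => f x) f p_infty (f x) l);
  [| apply is_lim_const | exact Hl].
exists x; intros y Hy; apply Hf; trivial; lra.
Qed.

(** A nondecreasing [f] lies below its limit [0] at both [x] and [- x], and antisymmetry turns the
    second bound into [0 <= f x]; otherwise [- f] is used. *)
Lemma dark_profile_lim_zero (f : R -> R) :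
  dark_profile f -> is_lim f p_infty 0 -> forall x, f x = 0.
Proof.
intros (Ha & [Hm | Hm] & _) Hl x.
- assert (H := nondecreasing_le_lim f 0 x Hm Hl).
  assert (H' := nondecreasing_le_lim f 0 (- x) Hm Hl).
  rewrite Ha in H'; lra.
- assert (Hm' : nondecreasing_on (fun _ => True) (fun y => - f y))
    by (intros y z Hy Hz Hyz; apply Ropp_le_contravar, (Hm y z Hy Hz Hyz)).
  assert (Hl' : is_lim (fun y => - f y) p_infty 0)
    by (rewrite <- Ropp_0; exact (is_lim_opp _ _ _ Hl)).
  assert (H := nondecreasing_le_lim _ 0 x Hm' Hl').
  assert (H' := nondecreasing_le_lim _ 0 (- x) Hm' Hl').
  simpl in H, H'; rewrite Ha in H'; lra.
Qed.

(** * Amplitudes and bands *)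

Lemma amplitude_of_envelopes (p c g gamma aX aC : R) :
  c <> 0 -> aX <> 0 ->
  (g * aX ^ 2 - p) * aX + gamma * aC = 0 -> - c * aC + gamma * aX = 0 ->
  g * aX ^ 2 = p - gamma ^ 2 / c /\ aC = gamma / c * aX.
Proof.
intros Hc HX E1 E2.
assert (EC : aC = gamma / c * aX).
{ apply (Rmult_eq_reg_l c); [| exact Hc].
  field_simplify; [lra | exact Hc]. }
split; [| exact EC].
subst aC; apply (Rmult_eq_reg_r aX); [| exact HX].
apply Rminus_diag_uniq; rewrite <- E1; field; exact Hc.
Qed.

Lemma amplitude_eq_inf (omegaX omegaC gamma g omega aX : R) :
  g <> 0 ->
  g * aX ^ 2 = (omega - omegaX) - gamma ^ 2 / (omega - omegaC) ->
  aX = phiX_inf omegaX omegaC gamma g omega \/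
  aX = - phiX_inf omegaX omegaC gamma g omega.
Proof.
intros Hg E; unfold phiX_inf; rewrite <- E.
replace (1 / g * (g * aX ^ 2)) with (Rsqr aX) by (unfold Rsqr; field; exact Hg).
rewrite sqrt_Rsqr_abs; unfold Rabs; destruct (Rcase_abs aX); lra.
Qed.

Ltac unfold_bands :=
  repeat match goal with
  | H : _ \/ _ |- _ => destruct H
  | H : _ /\ _ |- _ => destruct H
  | H : ?x < Rmin _ _ |- _ => apply Rmin_Rgt_l in H
  | H : ?x > Rmax _ _ |- _ => apply Rmax_Rlt in H
  | H : band_1_1 _ _ _ _ _ |- _ => unfold band_1_1 in H
  | H : band_1_2 _ _ _ _ _ |- _ => unfold band_1_2 in H
  | H : band_2_1 _ _ _ _ _ |- _ => unfold band_2_1 in H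
  | H : band_2_2 _ _ _ _ _ |- _ => unfold band_2_2 in H
  | H : band_3_1 _ _ _ _ _ |- _ => unfold band_3_1 in H
  | H : band_3_2 _ _ _ _ _ |- _ => unfold band_3_2 in H
  end.

(** The sign of [g] separates all pairs except those with band 3.1; there the thresholds [9 / 8] and
    [3 / 2], or the sides of [omegaC] and [omegaX], are incompatible. *)
Lemma zero_nonzero_bands_disjoint (omegaX omegaC gamma g omega : R) :
  gamma <> 0 ->
  band_2_1 omegaX omegaC gamma g omega \/ band_2_2 omegaX omegaC gamma g omega ->
  band_1_1 omegaX omegaC gamma g omega \/ band_1_2 omegaX omegaC gamma g omega \/
  band_3_1 omegaX omegaC gamma g omega \/ band_3_2 omegaX omegaC gamma g omega ->
  False.
Proof.
intros Hgamma H2 H13.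
assert (0 < gamma ^ 2) by now apply pow2_gt_0.
unfold_bands; lra.
Qed.

Lemma band_varpiC_neq_zero (omegaX omegaC gamma g omega : R) :
  band_1_1 omegaX omegaC gamma g omega \/ band_1_2 omegaX omegaC gamma g omega \/
  band_3_1 omegaX omegaC gamma g omega \/ band_3_2 omegaX omegaC gamma g omega ->
  omega - omegaC <> 0.
Proof. intros H; unfold_bands; lra. Qed.

(** * Far-field states of the three kinds of soliton *)

(** A zero limit makes [phiX] vanish identically, then [phiC] too by the first envelope equation,
    against nonconstancy. *)
Lemma dark_soliton_limit_neq_zero (omegaX omegaC gamma g omega : R)
    (phiX phiC : R -> R) (aX : R) :
  gamma <> 0 -> nonconstant phiX phiC ->
  dark_soliton omegaX omegaC gamma g omega phiX phiC ->
  is_lim phiX p_infty aX -> aX <> 0.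
Proof.
intros Hgamma Hnc (_ & Hcl & x0 & Hdark & _) HX ->.
assert (HX0 : forall x, phiX x = 0).
{ intros x; replace x with (x0 + (x - x0)) by ring.
  apply (dark_profile_lim_zero _ Hdark), is_lim_shift, HX. }
apply Hnc; exists 0, 0; intros x; split; [apply HX0 |].
destruct (envelopes_of_solution _ _ _ _ _ _ _ _ (Hcl x 0 I)) as [E _].
rewrite HX0 in E; nra.
Qed.

Lemma discontinuous_soliton_limit_neq_zero (omegaX omegaC gamma g omega : R)
    (phiX phiC : R -> R) (aX : R) :
  g <> 0 -> discontinuous_soliton omegaX omegaC gamma g omega phiX phiC ->
  is_lim phiX p_infty aX -> aX <> 0.
Proof.
intros Hg (_ & x0 & _ & _ & (_ & Hlim) & Hband) HX ->.
assert (H := is_lim_Rabs _ _ _ (is_lim_shift _ x0 _ HX)).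
assert (E := is_lim_finite_unique _ _ _ _ H Hlim).
rewrite Rabs_R0 in E; symmetry in E; apply Rmult_integral in E.
assert (Hc : omega - omegaC <> 0)
  by (apply (band_varpiC_neq_zero omegaX omegaC gamma g); tauto).
destruct E as [E | E].
- revert E; apply Rinv_neq_0_compat, Rgt_not_eq, sqrt_lt_R0.
  now apply Rabs_pos_lt.
- apply sqrt_eq_0 in E; [| apply Rabs_pos].
  destruct (Req_dec (omega - omegaX - gamma ^ 2 / (omega - omegaC)) 0) as [E' | E'];
    [| now apply Rabs_no_R0 in E'].
  apply (f_equal (Rmult (omega - omegaC))) in E'.
  replace (_ * (_ - _))
    with ((omega - omegaX) * (omega - omegaC) - gamma ^ 2) in E' by (field; exact Hc).
  assert (H2 := pow2_ge_0 gamma).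
  (* A zero limit would mean [varpi_X varpi_C = gamma^2]; this product exceeds [3 / 2 * gamma^2] in
     band 3.1 and is negative in band 3.2. *)
  destruct Hband as [[HB _] | [HB _]]; unfold_bands; nra.
Qed.

Lemma soliton_cases (omegaX omegaC gamma g omega : R) (phiX phiC : R -> R)
    (aX aC : R) :
  gamma <> 0 -> g <> 0 -> nonconstant phiX phiC ->
  soliton omegaX omegaC gamma g omega phiX phiC ->
  is_lim phiX p_infty aX -> is_lim phiC p_infty aC ->
  (exists x0,
     classical_on (fun x => x <> x0) omegaX omegaC gamma g omega phiX phiC) /\
  is_lim phiX m_infty (- aX) /\ is_lim phiC m_infty (- aC) /\
  ((band_2_1 omegaX omegaC gamma g omega \/ band_2_2 omegaX omegaC gamma g omega) /\
   aX = 0 /\ aC = 0 \/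
   (band_1_1 omegaX omegaC gamma g omega \/ band_1_2 omegaX omegaC gamma g omega \/
    band_3_1 omegaX omegaC gamma g omega \/ band_3_2 omegaX omegaC gamma g omega) /\
   aX <> 0).
Proof.
intros Hgamma Hg Hnc [Hd | [Hb | Hd]] HX HC.
- assert (HX0 := dark_soliton_limit_neq_zero _ _ _ _ _ _ _ _ Hgamma Hnc Hd HX).
  destruct Hd as (Hband & Hcl & x0 & [HaX _] & [HaC _]).
  split; [exists x0; intros x t _; now apply Hcl |].
  split; [now apply (is_lim_antisymmetric phiX x0) |].
  split; [now apply (is_lim_antisymmetric phiC x0) |].
  right; tauto.
- destruct Hb as (Hband & Hcl & x0 & (HsX & _ & _ & HlX & _) & (HsC & _ & _ & HlC & _)).
  assert (EX := is_lim_finite_unique _ _ _ _ (is_lim_shift _ x0 _ HX) HlX).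
  assert (EC := is_lim_finite_unique _ _ _ _ (is_lim_shift _ x0 _ HC) HlC).
  subst aX aC; rewrite Ropp_0.
  split; [exists x0; intros x t _; now apply Hcl |].
  split; [now apply (is_lim_symmetric phiX x0) |].
  split; [now apply (is_lim_symmetric phiC x0) |].
  left; tauto.
- assert (HX0 := discontinuous_soliton_limit_neq_zero _ _ _ _ _ _ _ _ Hg Hd HX).
  destruct Hd as (_ & x0 & Hcl & (HaX & HaC & _) & _ & Hband).
  split; [now exists x0 |].
  split; [now apply (is_lim_antisymmetric phiX x0) |].
  split; [now apply (is_lim_antisymmetric phiC x0) |].
  right; tauto.
Qed.

Theorem theorem3 :
  forall (omegaX omegaC gamma g omega : R) (phiX phiC : R -> R)
    (phiX_star phiC_star : R),
  gamma <> 0 ->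
  g <> 0 ->
  nonconstant phiX phiC ->
  soliton omegaX omegaC gamma g omega phiX phiC ->
  is_lim phiX p_infty phiX_star ->
  is_lim phiC p_infty phiC_star ->
  ex_finite_lim phiX m_infty ->
  ex_finite_lim phiC m_infty ->
  (is_lim phiX m_infty (- phiX_star) /\ is_lim phiC m_infty (- phiC_star)) /\
  homogeneous_solution omegaX omegaC gamma g omega phiX_star phiC_star /\
  (band_1_1 omegaX omegaC gamma g omega \/
   band_2_1 omegaX omegaC gamma g omega \/
   band_2_2 omegaX omegaC gamma g omega \/
   band_3_2 omegaX omegaC gamma g omega ->
   linearly_stable omegaX omegaC gamma g omega phiX_star) /\
  (band_1_2 omegaX omegaC gamma g omega \/
   band_3_1 omegaX omegaC gamma g omega ->
   linearly_unstable omegaX omegaC gamma g omega phiX_star) /\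
  (band_2_1 omegaX omegaC gamma g omega \/
   band_2_2 omegaX omegaC gamma g omega ->
   phiX_star = 0 /\ phiC_star = 0) /\
  (band_1_1 omegaX omegaC gamma g omega \/
   band_1_2 omegaX omegaC gamma g omega \/
   band_3_1 omegaX omegaC gamma g omega \/
   band_3_2 omegaX omegaC gamma g omega ->
   (phiX_star = phiX_inf omegaX omegaC gamma g omega /\
    phiC_star = phiC_inf omegaX omegaC gamma g omega) \/
   (phiX_star = - phiX_inf omegaX omegaC gamma g omega /\
    phiC_star = - phiC_inf omegaX omegaC gamma g omega)).
Proof.
intros omegaX omegaC gamma g omega phiX phiC aX aC Hgamma Hg Hnc Hsol HX HC _ _.
destruct (soliton_cases _ _ _ _ _ _ _ aX aC Hgamma Hg Hnc Hsol HX HC)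
  as ((x0 & Hcl) & HmX & HmC & Hcase).
destruct (asymptotic_envelopes _ _ _ _ _ _ _ _ _ _ Hcl HX HC) as [E1 E2].
split; [now split |].
split; [now apply homogeneous_solution_of_envelopes |].
destruct Hcase as [(Hband & -> & ->) | (Hband & HX0)].
- assert (Hno := zero_nonzero_bands_disjoint _ _ _ _ _ Hgamma Hband).
  split; [intros _; apply linearly_stable_zero |].
  split; [intros H; exfalso; tauto |].
  split; [now split |].
  intros H; contradiction.
- assert (Hc := band_varpiC_neq_zero _ _ _ _ _ Hband).
  destruct (amplitude_of_envelopes _ _ _ _ _ _ Hc HX0 E1 E2) as [Ez EC].
  assert (Hno : band_2_1 omegaX omegaC gamma g omega \/
                band_2_2 omegaX omegaC gamma g omega -> False)
    by (intros H; exact (zero_nonzero_bands_disjoint _ _ _ _ _ Hgamma H Hband)).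
  (* Each stability clause brings its own band hypothesis; [unfold_bands] must not split the
     soliton's band as well. *)
  clear Hband Hsol.
  assert (HX2 : 0 < aX ^ 2) by now apply pow2_gt_0.
  split; [| split; [| split]].
  (* Bands 1.1 and 3.2 both have [g > 0] and [varpi_C < 0]. *)
  + intros [H | [H | [H | H]]]; [| tauto | tauto |].
    * apply linearly_stable_nonzero; unfold_bands; [lra | nra | exact Ez].
    * apply linearly_stable_nonzero; unfold_bands; [lra | nra | exact Ez].
  + intros [H | H].
    * apply linearly_unstable_pos; unfold_bands; [exact Hgamma | lra | now split | exact Ez].
    * apply linearly_unstable_neg; unfold_bands; [exact Hgamma | lra | assumption | exact Ez].
  + intros H; contradiction.
  + intros _; rewrite EC; unfold phiC_inf.
    destruct (amplitude_eq_inf _ _ _ _ _ _ Hg Ez) as [E | E]; rewrite E; [left | right];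
      (split; [reflexivity | ring]).
Qed.
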